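(* The deception bonus against an opponent using Empirical Risk Minimization can be $\Omega(T)$ even when payoffs are bounded by a constant: there exist constants $K>0$, $c>0$, $T_0\in\mathbb{N}$ and, for each $T\ge T_0$, a finite two-player normal-form game with $|u^A|,|u^B|\le K$ such that the deception bonus of player $A$ in the $T$-round repetition of this game against $\mathsf{ERM}$ is at least $cT$.
   Context: Setting. A two-player normal-form game is repeated for $T$ rounds. Player $A$ (the optimizer, row player) has a finite action set $\mathcal{A}$, player $B$ (the opponent, column player) has a finite action set $\mathcal{B}$, with utilities $u^A,u^B:\mathcal{A}\times\mathcal{B}\to\mathbb{R}$ received once per round. The payoffs of the game are allowed to depend on $T$. Empirical Risk Minimization ($\mathsf{ERM}$): in round $t$, when player $A$ has played $a_1,\dots,a_{t-1}$, player $B$ plays $\mathsf{ERM}([a_1,\dots,a_{t-1}])=\arg\max_{b\in\mathcal{B}}\sum_{i=1}^{t-1}u^B(a_i,b)$, ties broken in favour of the leftmost action in a fixed order on $\mathcal{B}$ (in round 1 all actions are tied). Deception bonus. Let $\mathbf{a}\in\Delta(\mathcal{A})$ be a Stackelberg leader strategy for $A$: a mixed strategy maximizing $A$'s expected utility against the best response of $B$, where $B$'s best response to $\mathbf{a}$ is $\mathbf{b}\in\arg\max_{b\in\mathcal{B}}\mathbb{E}_{a'\sim\mathbf{a}}[u^B(a',b)]$ (ties among best responses in this one-shot benchmark are broken in favour of $A$). The deception bonus is $$\Big[\max_{(a_t)_{t=1}^T\in\mathcal{A}^T}\sum_{t=1}^T u^A(a_t,b_t)\Big]-T\cdot\mathbb{E}_{a'\sim\mathbf{a}}[u^A(a',\mathbf{b})],\qquad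 b_t=\mathsf{ERM}([a_1,\dots,a_{t-1}]).$$ *)

(* Defs.v *)
From HB Require Import structures.
From mathcomp Require Import all_boot all_order all_algebra.
From mathcomp Require Import boolp classical_sets reals.

Set Implicit Arguments.
Unset Strict Implicit.
Unset Printing Implicit Defensive.

Import Order.TTheory GRing.Theory Num.Theory.
Local Open Scope ring_scope.

(* [opponent] is a nonempty finite totally ordered type; its order is the
   left-to-right order used to break ties. *)
Record game (R : realType) := Game {
  optimizer : finType;
  optimizer_gt0 : (0 < #|optimizer|)%N;
  opponent_disp : Order.disp_t;
  opponent : finTBOrderType opponent_disp;
  uA : optimizer -> opponent -> R;
  uB : optimizer -> opponent -> R }.

Arguments uA {R} g _ _.
Arguments uB {R} g _ _.

Definition is_ERM_maximizer (R : realType) (g : game R)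
    (h : seq (optimizer g)) (b : opponent g) : bool :=
  [forall b', \sum_(a <- h) uB g a b' <= \sum_(a <- h) uB g a b].

(* The maximizers form a nonempty subset of a total order, so their minimum
   is the leftmost one. *)
Definition ERM (R : realType) (g : game R) (h : seq (optimizer g)) :
    opponent g :=
  \big[Order.min/Order.top]_(b | is_ERM_maximizer h b) b.

(* With 0-based [t], the actions preceding round [t] are [take t s]. *)
Definition repeated_payoff (R : realType) (g : game R) (T : nat)
    (s : T.-tuple (optimizer g)) : R :=
  \sum_(t < T) uA g (tnth s t) (ERM (take t s)).

(* The range is finite and nonempty, so [sup] is a maximum. *)
Definition max_repeated_payoff (R : realType) (g : game R) (T : nat) : R :=
  sup (range (@repeated_payoff R g T)).

Definition is_mixed (R : realType) (A : finType) (p : {ffun A -> R}) : Prop :=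
  (forall a, 0 <= p a) /\ \sum_a p a = 1.

Definition expected (R : realType) (A : finType) (p : {ffun A -> R})
    (u : A -> R) : R :=
  \sum_a p a * u a.

Definition best_response (R : realType) (g : game R)
    (p : {ffun optimizer g -> R}) (b : opponent g) : Prop :=
  forall b', expected p (uB g ^~ b') <= expected p (uB g ^~ b).

Definition favourable_best_response (R : realType) (g : game R)
    (p : {ffun optimizer g -> R}) (b : opponent g) : Prop :=
  best_response p b /\
  forall b', best_response p b' ->
    expected p (uA g ^~ b') <= expected p (uA g ^~ b).

Definition is_stackelberg (R : realType) (g : game R)
    (p : {ffun optimizer g -> R}) (b : opponent g) : Prop :=
  [/\ is_mixed p,
      favourable_best_response p b &
      forall p' b', is_mixed p' -> favourable_best_response p' b' ->
        expected p' (uA g ^~ b') <= expected p (uA g ^~ b)].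

Definition deception_bonus (R : realType) (g : game R) (T : nat)
    (p : {ffun optimizer g -> R}) (b : opponent g) : R :=
  max_repeated_payoff g T - T%:R * expected p (uA g ^~ b).

(* Main.v *)
(* One game, independent of T, works. Its utilities (u^A, u^B) are
              Left       Middle      Right
     Up      (0,  0)    (-2, -1)    (-2, 0)
     Down    (0, -1)    (-2,  1)    ( 2, 0)
   If Right is a best response, then it is at least as good as Middle, so Up
   has probability at least 1/2 and the optimizer gets at most 0: the
   Stackelberg value is 0. Yet by playing Up during the first half and Down
   during the second, the optimizer pays nothing while ERM breaks the tie
   towards Left; after one Down, Left is spoilt, whereas the long past of Ups
   keeps Middle behind Right, so the optimizer earns 2 per remaining round. *)

Require Import Defs.
From HB Require Import structures.
From mathcomp Require Import all_boot all_order all_algebra.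
From mathcomp Require Import boolp classical_sets reals.
From mathcomp Require Import zify lra.

Set Implicit Arguments.
Unset Strict Implicit.
Unset Printing Implicit Defensive.

Import Order.TTheory GRing.Theory Num.Theory.
Local Open Scope ring_scope.

(* MathComp declares bottom and top of ['I_n.+1] before its total order, and
   does not join them. *)
HB.saturate ordinal.

Lemma ERM_leftmost (R : realType) (g : game R) (h : seq (optimizer g))
    (b : opponent g) :
  is_ERM_maximizer h b ->
  (forall b', is_ERM_maximizer h b' -> (b <= b')%O) -> ERM h = b.
Proof.
move=> hb b_le; apply/le_anti/andP; split; first exact: bigmin_le_cond.
by apply: le_bigmin => //; exact: lex1.
Qed.

Lemma repeated_payoff_le_max (R : realType) (g : game R) (T : nat)
    (s : T.-tuple (optimizer g)) :
  repeated_payoff s <= max_repeated_payoff g T.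
Proof.
apply: ub_le_sup; last by exists s.
(* [sup] needs an upper bound; there are finitely many plays, so the sum of all absolute payoffs is
   one. *)
exists (\sum_(s' : T.-tuple (optimizer g)) `|repeated_payoff s'|).
move=> _ [s' _ <-]; apply: (le_trans (ler_norm _)).
by rewrite (bigD1 s') //= lerDl sumr_ge0.
Qed.

Section DeceptionGame.
Variable R : realType.

(* Rows: [true] is Up, [false] is Down.
   Columns: 0 is Left, 1 is Middle, 2 is Right. *)
Definition deception_uA (a : bool) (b : 'I_3) : R :=
  match val b with 0%N => 0 | 1%N => -2 | _ => if a then -2 else 2 end.

Definition deception_uB (a : bool) (b : 'I_3) : R :=
  match val b with
  | 0%N => if a then 0 else -1
  | 1%N => if a then -1 else 1
  | _ => 0
  end.

Lemma card_bool_gt0 : (0 < #|{: bool}|)%N.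
Proof. by rewrite card_bool. Qed.

Definition deception_game : game R :=
  @Game R bool card_bool_gt0 _ 'I_3 deception_uA deception_uB.

Lemma expected_bool (p : {ffun bool -> R}) (u : bool -> R) :
  expected p u = p true * u true + p false * u false.
Proof. by rewrite /expected big_bool. Qed.

Lemma ord3P (P : 'I_3 -> Prop) :
  P ord0 -> P (inord 1) -> P ord_max -> forall b, P b.
Proof.
move=> P0 P1 P2 [[|[|[|m]]] lt_m3] //.
- by rewrite (_ : Ordinal _ = ord0) //; apply: val_inj.
- by rewrite (_ : Ordinal _ = inord 1) //; apply: val_inj; rewrite /= inordK.
- by rewrite (_ : Ordinal _ = ord_max) //; apply: val_inj.
Qed.

Lemma best_response_value_le0 (p : {ffun optimizer deception_game -> R})
    (b : opponent deception_game) :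
  is_mixed p -> best_response p b ->
  expected p (uA deception_game ^~ b) <= 0.
Proof.
move=> [p_ge0 p_sum].
have := p_ge0 true; have := p_ge0 false; move: p_sum; rewrite big_bool /=.
(* Comparing with Middle suffices: for Right it gives [p false <= p true], while Left and Middle pay
   0 and -2 anyway. *)
move: b; apply: ord3P => p_sum p0 p1 /(_ (inord 1 : 'I_3));
  rewrite !expected_bool /= /deception_uA /deception_uB /= ?inordK //; lra.
Qed.

Lemma deception_stackelberg :
  exists p b, @is_stackelberg R deception_game p b.
Proof.
(* Pure Up: Left ties with Right for the opponent and gives the optimizer 0, the upper bound. *)
pose p : {ffun bool -> R} := [ffun a : bool => a%:R].
exists p, (ord0 : 'I_3).
have p_value : expected p (deception_uA ^~ ord0) = 0.
  by rewrite expected_bool !mulr0 addr0.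
split.
- split; first by move=> a; rewrite ffunE ler0n.
  by rewrite big_bool !ffunE /= mulr0n addr0.
- split; first by apply: ord3P; rewrite !expected_bool !ffunE
    /= /deception_uB /= ?inordK //; lra.
  by apply: ord3P => _; rewrite !expected_bool !ffunE
    /= /deception_uA /= ?inordK //; lra.
- move=> p' b' p'_mixed [b'_br _].
  by rewrite /= p_value; exact: best_response_value_le0.
Qed.

Lemma ERM_up (n : nat) :
  ERM (g := deception_game) (nseq n true) = (ord0 : 'I_3).
Proof.
apply: ERM_leftmost; last by move=> b' _; exact: le0x.
apply/forallP; apply: ord3P;
  rewrite !big_nseq !iter_addr_0 /= /deception_uB /= ?inordK // mul0rn //.
by rewrite mulrn_wle0 //; lra.
Qed.

(** Left, Middle and Right score [-m], [m - n] and 0, so Right is the only maximizer. *)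
Lemma ERM_up_down (n m : nat) : (0 < m < n)%N ->
  ERM (g := deception_game) (nseq n true ++ nseq m false) = (ord_max : 'I_3).
Proof.
case/andP=> m_gt0 lt_mn.
have m_gt0R : 0 < m%:R :> R by rewrite ltr0n.
have lt_mnR : m%:R < n%:R :> R by rewrite ltr_nat.
have score b : \sum_(a <- nseq n true ++ nseq m false) deception_uB a b =
    n%:R * deception_uB true b + m%:R * deception_uB false b.
  by rewrite big_cat !big_nseq !iter_addr_0 /= -!(mulr_natl (deception_uB _ _)).
apply: ERM_leftmost.
  apply/forallP; apply: ord3P;
    rewrite /= !score /deception_uB /= ?inordK //; lra.
apply: ord3P => // /forallP /(_ (ord_max : 'I_3)) /= le_score; exfalso;
  move: le_score; rewrite !score /deception_uB /= ?inordK //; lra.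
Qed.

Definition deceptive_play (T : nat) : seq bool :=
  nseq (uphalf T) true ++ nseq T./2 false.

Lemma size_deceptive_play (T : nat) : size (deceptive_play T) == T.
Proof. by rewrite size_cat !size_nseq; lia. Qed.

Lemma deceptive_payoff (T : nat) :
  repeated_payoff (g := deception_game) (Tuple (size_deceptive_play T)) =
  2 *+ (T./2).-1.
Proof.
(* Round [t = uphalf T] is the first Down, but its history is still all Up: Left is played and the
   round earns 0. *)
transitivity (\sum_(t < T) (if (t <= uphalf T)%N then 0 else 2 : R)).
  apply: eq_bigr => t _; have lt_tT := ltn_ord t.
  rewrite (tnth_nth true) /= /deceptive_play nth_cat take_cat !size_nseq.
  case: (ltngtP t (uphalf T)) => [lt_tU|lt_Ut|->].
  - by rewrite take_nseq ?ERM_up // ltnW.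
  - rewrite take_nseq; last by lia.
    rewrite ERM_up_down; last by lia.
    by rewrite nth_nseq ifT //; lia.
  - by rewrite subnn take0 cats0 ERM_up.
have sum_late n m :
    \sum_(t < n) (if (t <= m)%N then 0 else 2 : R) = 2 *+ (n - m.+1).
  elim: n => [|n IHn]; first by rewrite big_ord0 mulr0n.
  rewrite big_ord_recr /= IHn; case: leqP => [le_nm|lt_mn].
    by rewrite addr0; congr (_ *+ _); lia.
  by rewrite -mulrSr -subSn.
by rewrite sum_late; congr (_ *+ _); lia.
Qed.

End DeceptionGame.

Theorem proposition2 (R : realType) :
  exists (K c : R) (T0 : nat),
    [/\ 0 < K, 0 < c &
    forall T : nat, (T0 <= T)%N ->
      exists g : game R,
        [/\ forall a b, `|uA g a b| <= K /\ `|uB g a b| <= K,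
            exists p b, @is_stackelberg R g p b &
            forall p b, @is_stackelberg R g p b ->
              c * T%:R <= deception_bonus T p b]].
Proof.
(* The payoff [2 *+ (T./2).-1] is at least [T / 2] for every [T >= 6], but not for [T = 5]. *)
exists 2, 2^-1, 6%N; split=> [||T le6T]; [lra | lra |].
exists (deception_game R); split; last 1 first.
- move=> p b [p_mixed [b_br _] _]; rewrite /deception_bonus.
  have value_le0 := best_response_value_le0 p_mixed b_br.
  have := repeated_payoff_le_max (g := deception_game R)
    (Tuple (size_deceptive_play T)).
  rewrite deceptive_payoff -mulr_natr.
  have : (T%:R : R) <= (4 * (T./2).-1)%:R by rewrite ler_nat; lia.
  have := mulr_ge0_le0 (ler0n R T) value_le0.
  rewrite natrM; lra.
- move=> a; apply: ord3P; case: a;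
    rewrite /= /deception_uA /deception_uB /= ?inordK //;
    rewrite ?normrN ?normr0 ?normr1 ?ger0_norm //; split; lra.
- exact: deception_stackelberg.
Qed.
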